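(* Let $(G_1,\sigma_1,\prec_1)$ and $(G_2,\sigma_2,\prec_2)$ be admissible UPO-graphs such that $G_1$ has $n$ output edges $o_1\prec_1\cdots\prec_1 o_n$ and $G_2$ has $n$ input edges $i_1\prec_2\cdots\prec_2 i_n$. Then the composition $(G,\sigma,\prec)=(G_2\circ G_1,\sigma,\prec_2\circ\prec_1)$ is an admissible UPO-graph, i.e. $\prec_2\circ\prec_1$ is an admissible upward planar order on the progressive graph $(G_2\circ G_1,\sigma)$.
   Context: Directed graphs are finite, may have multiple edges, and each edge $e$ has source $s(e)$ and target $t(e)$. $I(v)$, $O(v)$ denote the incoming and outgoing edges of a vertex $v$, and $E(v)=I(v)\cup O(v)$. $e_1\to e_2$ means there is a directed path starting with edge $e_1$ and ending with edge $e_2$. For a subset $X$ of a finite linearly ordered set, $\overline{X}$ is the set of elements between $\min X$ and $\max X$ inclusive. An upward planar order on a finite acyclic directed graph $G$ is a linear order $\prec$ on $E(G)$ such that (i) $e_1\to e_2$ implies $e_1\prec e_2$; (ii) for every vertex $v$, $\overline{I(v)}\cap\overline{O(v)}=\emptyset$ and $\overline{E(v)}=\overline{I(v)}\sqcup\overline{O(v)}$; (iii) for any vertices $v_1,v_2$, $I(v_1)\cap\overline{I(v_2)}\neq\emptyset$ implies $\overline{I(v_1)}\subseteq\overline{I(v_2)}$, and $O(v_1)\cap\overline{O(v_2)}\neq\emptyset$ implies $\overline{O(v_1)}\subseteq\overline{O(v_2)}$. A progressive graph $(G,\sigma)$ is a finite acyclic directed graph $G$ with a distinguished subset $\sigma$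 of vertices of degree one (boundary vertices); the other vertices are inner vertices. Boundary sources are input vertices, boundary sinks are output vertices. Edges starting at a boundary vertex are input edges, forming $I(G)$; edges ending at a boundary vertex are output edges, forming $O(G)$. An upward planar order $\prec$ on $(G,\sigma)$ is admissible if for every inner vertex $v$, $I(G)\cap\overline{O(v)}=\emptyset$ and $O(G)\cap\overline{I(v)}=\emptyset$; $(G,\sigma,\prec)$ is then an admissible UPO-graph. Composition: given $(G_1,\sigma_1,\prec_1)$ with output edges $o_1\prec_1\cdots\prec_1 o_n$ and $(G_2,\sigma_2,\prec_2)$ with input edges $i_1\prec_2\cdots\prec_2 i_n$, the graph $G=G_2\circ G_1$ is obtained by deleting the output vertices of $G_1$ and the input vertices of $G_2$ and, for each $k$, replacing $o_k$ and $i_k$ by a single edge $\overline{e_k}$ with source $s(o_k)$ and target $t(i_k)$; its boundary $\sigma$ consists of the input vertices of $G_1$ and the output vertices of $G_2$. Write $(E(G_1),\prec_1)$ as the consecutive blocks $Q_1,\{o_1\},Q_2,\{o_2\},\dots,Q_n,\{o_n\},Q_{n+1}$ (so $Q_1$ is the set of edges before $o_1$, $Q_k$ those strictly between $o_{k-1}$ and $o_k$, $Q_{n+1}$ those after $o_n$), and $(E(G_2),\prec_2)$ as $P_0,\{i_1\},P_1,\dots,\{i_n\},P_n$ similarly. The composed order $\prec=\prec_2\circ\prec_1$ on $E(G)$ is the linear order whose consecutive blocks are $P_0,Q_1,\{\overline{e_1}\},P_1,Q_2,\{\overline{e_2}\},P_2,\dots,Q_n,\{\overline{e_n}\},P_n,Q_{n+1}$,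 with each $Q_k$ ordered by $\prec_1$ and each $P_k$ by $\prec_2$. *)

(* Defs.v *)
From mathcomp Require Import all_boot.

Set Implicit Arguments.
Unset Strict Implicit.
Unset Printing Implicit Defensive.

Record digraph := Digraph {
  vertex : finType;
  edge : finType;
  src : edge -> vertex;
  tgt : edge -> vertex }.

Section Digraph.
Variable G : digraph.
Implicit Types (v : vertex G) (e f : edge G).

Definition in_edges v : {set edge G} := [set e | tgt e == v].
Definition out_edges v : {set edge G} := [set e | src e == v].
Definition inc_edges v : {set edge G} := in_edges v :|: out_edges v.
Definition degree v : nat := #|in_edges v| + #|out_edges v|.

Definition adj : rel (edge G) := [rel e f | tgt e == src f].

Definition acyclic : Prop := forall c : seq (edge G), cycle adj c -> c = [::].

(* e1 -> e2. Only paths with at least two edges are considered: the one-edge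
   path would give e -> e, which is incompatible with a strict order. *)
Definition leads_to e1 e2 : Prop :=
  exists p : seq (edge G), path adj e1 (rcons p e2).

End Digraph.

Section LinearOrder.
Variables (T : finType) (r : rel T).
Implicit Types (X : {set T}) (a b x : T).

Definition strict_linear_order : Prop :=
  [/\ irreflexive r, transitive r & forall x y, x != y -> r x y || r y x].

Definition ord_le : rel T := [rel x y | (x == y) || r x y].

Definition is_min X a : bool := (a \in X) && [forall x in X, ord_le a x].
Definition is_max X b : bool := (b \in X) && [forall x in X, ord_le x b].

(* The interval [min X, max X]; it is empty when X is. *)
Definition hull X : {set T} :=
  [set x | [exists a, exists b,
     [&& is_min X a, is_max X b, ord_le a x & ord_le x b]]].

(* t lists the elements of X in increasing order. *)
Definition increasing_listing n (X : {set T}) (t : n.-tuple T) : Prop :=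
  sorted r t /\ t =i X.

End LinearOrder.

Record upward_planar_order (G : digraph) (r : rel (edge G)) : Prop :=
  UpwardPlanarOrder {
    upo_linear : strict_linear_order r;
    upo_path : forall e1 e2, leads_to e1 e2 -> r e1 e2;
    upo_disjoint : forall v,
      hull r (in_edges v) :&: hull r (out_edges v) = set0;
    upo_cover : forall v,
      hull r (inc_edges v) = hull r (in_edges v) :|: hull r (out_edges v);
    upo_in : forall v1 v2,
      in_edges v1 :&: hull r (in_edges v2) != set0 ->
      hull r (in_edges v1) \subset hull r (in_edges v2);
    upo_out : forall v1 v2,
      out_edges v1 :&: hull r (out_edges v2) != set0 ->
      hull r (out_edges v1) \subset hull r (out_edges v2) }.

Section Progressive.
Variables (G : digraph) (sigma : {set vertex G}).

Definition progressive : Prop :=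
  acyclic G /\ (forall v, v \in sigma -> degree v = 1).

Definition input_vertices : {set vertex G} :=
  [set v in sigma | in_edges v == set0].
Definition output_vertices : {set vertex G} :=
  [set v in sigma | out_edges v == set0].

Definition input_edges : {set edge G} := [set e | src e \in sigma].
Definition output_edges : {set edge G} := [set e | tgt e \in sigma].

Definition admissible (r : rel (edge G)) : Prop :=
  forall v, v \notin sigma ->
    input_edges :&: hull r (out_edges v) = set0 /\
    output_edges :&: hull r (in_edges v) = set0.

Record admissible_UPO_graph (r : rel (edge G)) : Prop := AdmissibleUPOGraph {
  aupo_progressive : progressive;
  aupo_upo : upward_planar_order r;
  aupo_admissible : admissible r }.

Lemma src_not_output e : src e \notin output_vertices.
Proof.
rewrite inE negb_and; apply/orP; right.
by apply/set0Pn; exists e; rewrite inE.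
Qed.

Lemma tgt_not_input e : tgt e \notin input_vertices.
Proof.
rewrite inE negb_and; apply/orP; right.
by apply/set0Pn; exists e; rewrite inE.
Qed.

Lemma tgt_not_output e : e \notin output_edges -> tgt e \notin output_vertices.
Proof. by rewrite !inE negb_and => ->. Qed.

Lemma src_not_input e : e \notin input_edges -> src e \notin input_vertices.
Proof. by rewrite !inE negb_and => ->. Qed.

End Progressive.

Section Composition.
Variables (G1 G2 : digraph) (s1 : {set vertex G1}) (s2 : {set vertex G2}).
Variables (r1 : rel (edge G1)) (r2 : rel (edge G2)).
Variables (n : nat) (o : n.-tuple (edge G1)) (i : n.-tuple (edge G2)).

Definition comp_vertex : finType :=
  ({v : vertex G1 | v \notin output_vertices s1} +
   {v : vertex G2 | v \notin input_vertices s2})%type.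

(* The index k : 'I_n stands for the edge obtained by gluing the k-th output
   edge of G1 to the k-th input edge of G2. *)
Definition comp_edge : finType :=
  ({e : edge G1 | e \notin output_edges s1} +
   {e : edge G2 | e \notin input_edges s2} + 'I_n)%type.

Definition comp_src (x : comp_edge) : comp_vertex :=
  match x with
  | inl (inl e) => inl (exist _ (src (val e)) (src_not_output s1 (val e)))
  | inl (inr e) => inr (exist _ (src (val e)) (src_not_input (valP e)))
  | inr k => inl (exist _ (src (tnth o k)) (src_not_output s1 (tnth o k)))
  end.

Definition comp_tgt (x : comp_edge) : comp_vertex :=
  match x with
  | inl (inl e) => inl (exist _ (tgt (val e)) (tgt_not_output (valP e)))
  | inl (inr e) => inr (exist _ (tgt (val e)) (tgt_not_input s2 (val e)))
  | inr k => inr (exist _ (tgt (tnth i k)) (tgt_not_input s2 (tnth i k)))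
  end.

Definition comp_graph : digraph := Digraph comp_src comp_tgt.

Definition comp_boundary : {set vertex comp_graph} :=
  [set x : comp_vertex | match x with
   | inl v => val v \in input_vertices s1
   | inr v => val v \in output_vertices s2
   end].

(* Position of the block containing an edge in the sequence
     P_0, Q_1, {e_1}, P_1, Q_2, {e_2}, P_2, ..., Q_n, {e_n}, P_n, Q_(n+1):
   P_j is at position 3 j, Q_(j+1) at 3 j + 1 and e_(j+1) at 3 j + 2.
   An edge of G1 lies in Q_(j+1) when exactly j of the o_k precede it, and an
   edge of G2 lies in P_j when exactly j of the i_k precede it. *)
Definition comp_block (x : comp_edge) : nat :=
  match x with
  | inl (inl e) => 3 * count (fun f => r1 f (val e)) o + 1
  | inl (inr e) => 3 * count (fun f => r2 f (val e)) i
  | inr k => 3 * k + 2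
  end.

(* Two distinct edges in the same block both come from G1 or both from G2. *)
Definition comp_order : rel (edge comp_graph) :=
  fun x y : comp_edge =>
  (comp_block x < comp_block y) ||
  (comp_block x == comp_block y) &&
  match x, y with
  | inl (inl e), inl (inl f) => r1 (val e) (val f)
  | inl (inr e), inl (inr f) => r2 (val e) (val f)
  | _, _ => false
  end.

End Composition.

Arguments comp_boundary {G1 G2} s1 s2 {n} o i.
Arguments comp_order {G1 G2} s1 s2 r1 r2 {n} o i.

(* Main.v *)
Require Import Defs.
From mathcomp Require Import all_boot.
From mathcomp Require Import zify.

(** The edge sets of G1 and G2 embed monotonically into that of the composite,
    they cover it, and they meet in the glued edges.  The composed order is
    shaped so that whenever an edge of G1 lies below an edge of G2, some glued
    edge separates them (lemma [separation]).  By admissibility no glued edge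
    lies in the hull of I(v) for v in G1, or in the hull of O(v) for v in G2;
    so these hulls contain only edges of their own graph.  Each condition on
    the composite then reduces to the same condition on G1 or on G2, except
    that of (iii) for vertices of different graphs, where I(v) or O(v), not
    being split by a glued edge, lies on one side of every edge of the other
    graph. *)

Set Implicit Arguments.
Unset Strict Implicit.
Unset Printing Implicit Defensive.

(** * Hulls and sorted listings in a finite linear order *)

Section LinearOrderTheory.
Variables (T : finType) (r : rel T).
Hypothesis lin_r : strict_linear_order r.
Implicit Types (x y a b : T) (X Y : {set T}).

Lemma ord_leE x y : ord_le r x y = (x == y) || r x y.
Proof. by []. Qed.

Lemma ord_lexx : reflexive (ord_le r).
Proof. by move=> x; rewrite ord_leE eqxx. Qed.

Lemma ord_ltW x y : r x y -> ord_le r x y.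
Proof. by rewrite ord_leE => ->; rewrite orbT. Qed.

Lemma ord_le_trans : transitive (ord_le r).
Proof.
case: lin_r => _ tr _ y x z; rewrite !ord_leE => /orP[/eqP->//|rxy] /orP[/eqP<-|ryz].
  by rewrite rxy orbT.
by rewrite (tr _ _ _ rxy ryz) orbT.
Qed.

Lemma ord_le_total : total (ord_le r).
Proof.
case: lin_r => _ _ tot x y; rewrite !ord_leE; case: eqVneq => //= xy.
by case/orP: (tot _ _ xy) => ->; rewrite ?orbT.
Qed.

Lemma ord_ltNge x y : r x y = ~~ ord_le r y x.
Proof.
case: lin_r => irr tr tot; rewrite ord_leE; apply/idP/idP => [rxy|].
  apply/negP => /orP[/eqP e|ryx]; first by rewrite e irr in rxy.
  by have := tr _ _ _ rxy ryx; rewrite irr.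
by rewrite negb_or => /andP[/tot/orP[->|->]].
Qed.

(** Frees membership in the hull from the extremal elements: if [a] and [b] in [X] bracket [x], then
    so do the minimum and the maximum of [X], which exist because [X] is finite and nonempty. *)
Lemma hullP x X :
  reflect (exists a b, [/\ a \in X, b \in X, ord_le r a x & ord_le r x b])
          (x \in hull r X).
Proof.
rewrite inE; apply: (iffP existsP) => [[a /existsP[b]]|[a [b [aX bX ax xb]]]].
  by case/and4P=> /andP[aX _] /andP[bX _] ax xb; exists a, b.
(* [extremumP] yields minima; the maximum is obtained as a minimum for the converse order. *)
have ge_refl : reflexive (fun y z => ord_le r z y) by exact: ord_lexx.
have ge_trans : transitive (fun y z => ord_le r z y).
  by move=> u v w uv wu; apply: ord_le_trans wu uv.
have ge_total : total (fun y z => ord_le r z y).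
  by move=> u v; apply: ord_le_total.
have [m mX min_m] := extremumP id ord_lexx ord_le_trans ord_le_total aX.
have [M MX max_M] := extremumP id ge_refl ge_trans ge_total bX.
exists m; apply/existsP; exists M; apply/and4P; split.
- by apply/andP; split; [exact: mX | apply/forall_inP].
- by apply/andP; split; [exact: MX | apply/forall_inP].
- exact: ord_le_trans (min_m _ aX) ax.
- exact: ord_le_trans xb (max_M _ bX).
Qed.

Lemma hull_min X Y : X \subset hull r Y -> hull r X \subset hull r Y.
Proof.
move/subsetP=> XY; apply/subsetP => x /hullP[a [b [/XY aY /XY bY ax xb]]].
have [c [_ [cY _ ca _]]] := hullP _ _ aY; have [_ [d [_ dY _ bd]]] := hullP _ _ bY.
by apply/hullP; exists c, d; split=> //; apply: ord_le_trans; eassumption.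
Qed.

Lemma sub_hull X : X \subset hull r X.
Proof. by apply/subsetP => x xX; apply/hullP; exists x, x; rewrite !ord_lexx. Qed.

Lemma hull_mono X Y : X \subset Y -> hull r X \subset hull r Y.
Proof. by move=> XY; apply/hull_min/(subset_trans XY)/sub_hull. Qed.

Lemma hull0 : hull r set0 = set0.
Proof. by apply/setP=> x; rewrite in_set0; apply/hullP=> -[a [b []]]; rewrite inE. Qed.

Section Listing.
Variables (n : nat) (X : {set T}) (t : n.-tuple T).
Hypothesis t_X : increasing_listing r X t.

Lemma listing_ltn (k l : 'I_n) : r (tnth t k) (tnth t l) = (k < l).
Proof.
case: lin_r t_X => irr tr _ [t_sorted _].
have lt_nth (p q : 'I_n) : p < q -> r (tnth t p) (tnth t q).
  have x0 := tnth t p; rewrite !(tnth_nth x0) => pq.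
  by apply: (sorted_ltn_nth tr) => //; rewrite inE size_tuple.
case: ltngtP => [/lt_nth//|/lt_nth|/val_inj->]; last exact: irr.
by move=> rlk; apply/negP => /(tr _ _ _ rlk); rewrite irr.
Qed.

(** Since [t] is sorted, its entries below [x] form a prefix, and the count is the length of that
    prefix. Indices start at 0, hence the strict inequality. *)
Lemma listing_count (k : 'I_n) x : r (tnth t k) x = (k < count (r^~ x) t).
Proof.
case: lin_r t_X => irr tr _ [t_sorted _].
have: k < size t by rewrite size_tuple.
have x0 := tnth t k; rewrite (tnth_nth x0).
elim: (val t) (val k) t_sorted => // y s IHs [|m] /= ys; have := order_path_min tr ys.
  move=> /allP min_y _; case: (boolP (r y x)) => //= nyx.
  rewrite -has_count; apply/esym/negbTE/hasPn => z /min_y yz.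
  by apply: contra nyx; apply: tr yz.
move=> /allP min_y; rewrite ltnS => ms; rewrite IHs ?(path_sorted ys) //.
case: (boolP (r y x)) => //= nyx; suff -> : count (r^~ x) s = 0 by [].
apply/eqP; rewrite -leqn0 leqNgt -has_count; apply/hasPn => z /min_y yz.
by apply: contra nyx; apply: tr yz.
Qed.

Lemma listing_countC (k : 'I_n) x :
  x \notin X -> r x (tnth t k) = (count (r^~ x) t <= k).
Proof.
move=> xX; rewrite ord_ltNge ord_leE listing_count negb_or -leqNgt.
suff -> : tnth t k != x by [].
by apply: contraNneq xX => <-; case: t_X => _ <-; apply: mem_tnth.
Qed.

Lemma listing_index x : x \in X -> exists k, tnth t k = x.
Proof. by case: t_X => _ <- /tnthP[k ->]; exists k. Qed.

Lemma listing_mem k : tnth t k \in X.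
Proof. by case: t_X => _ <-; apply: mem_tnth. Qed.

(** The count is weakly increasing in its argument, so comparing counts first and using [r] only to
    break ties gives back [r]. This is the shape in which [comp_order] compares two edges of the
    same graph. *)
Lemma count_below x y :
  r x y = (count (r^~ x) t < count (r^~ y) t)
          || (count (r^~ x) t == count (r^~ y) t) && r x y.
Proof.
case: lin_r => irr tr tot.
have le_count u v : r u v -> count (r^~ u) t <= count (r^~ v) t.
  by move=> ruv; apply: sub_count => z /tr; apply.
case: (boolP (r x y)) => [/le_count|nrxy]; first by case: ltngtP.
rewrite andbF orbF; apply/esym/negbTE; rewrite -leqNgt.
have [->//|/tot] := eqVneq x y.
by rewrite (negbTE nrxy) => /le_count.
Qed.

End Listing.
End LinearOrderTheory.

(** * Hulls under order embeddings *)

Section Embedding.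
Variables (T U : finType) (r : rel T) (q : rel U) (j : T -> U).
Implicit Types (x y : T) (u : U) (X Y : {set T}).
Hypotheses (lin_r : strict_linear_order r) (lin_q : strict_linear_order q).
Hypothesis j_mono : forall x y, q (j x) (j y) = r x y.

Lemma embedding_inj : injective j.
Proof.
case: lin_r lin_q => _ _ tot [irr _ _] x y jxy; apply/eqP; apply: contraT.
by move/tot; rewrite -!j_mono jxy irr.
Qed.

Lemma embedding_le x y : ord_le q (j x) (j y) = ord_le r x y.
Proof. by rewrite !ord_leE j_mono (inj_eq embedding_inj). Qed.

Lemma hull_imsetP u X :
  reflect (exists a b, [/\ a \in X, b \in X, ord_le q (j a) u & ord_le q u (j b)])
          (u \in hull q (j @: X)).
Proof.
apply: (iffP (hullP lin_q _ _)) => [[a' [b' []]]|[a [b [aX bX au ub]]]].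
  by move=> /imsetP[a aX ->] /imsetP[b bX ->]; exists a, b.
by exists (j a), (j b); rewrite !imset_f.
Qed.

Lemma mem_hull_imset x X : (j x \in hull q (j @: X)) = (x \in hull r X).
Proof.
apply/hull_imsetP/(hullP lin_r) => -[a [b [aX bX ax xb]]]; exists a, b;
by rewrite ?embedding_le in ax xb *.
Qed.

Lemma hull_imset_sub X Y :
  hull r X \subset hull r Y -> hull q (j @: X) \subset hull q (j @: Y).
Proof.
move=> XY; apply: hull_min => //; apply/subsetP => _ /imsetP[x xX ->].
by rewrite mem_hull_imset (subsetP XY) // (subsetP (sub_hull lin_r X)).
Qed.

End Embedding.

(** * Orders increasing along adjacent edges, and boundary edges of admissible graphs *)

Section UPO.
Variables (G : digraph) (s : {set vertex G}) (r : rel (edge G)).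
Implicit Types (v : vertex G) (e : edge G).

Lemma adj_leads_to e f : adj e f -> leads_to e f.
Proof. by move=> ef; exists [::]; rewrite /= ef. Qed.

Lemma in_out_adj v e f : e \in in_edges v -> f \in out_edges v -> adj e f.
Proof. by rewrite !inE => /eqP te /eqP sf; rewrite /adj /= te sf. Qed.

Hypothesis lin_r : strict_linear_order r.

Section Adjacent.
Hypothesis adj_r : forall e f, adj e f -> r e f.

Lemma adj_path_lt e p : path (@adj G) e p -> path r e p.
Proof. exact: sub_path. Qed.

Lemma leads_to_lt e f : leads_to e f -> r e f.
Proof.
case: lin_r => _ tr _ [p /adj_path_lt /(order_path_min tr) /allP]; apply.
by rewrite mem_rcons mem_head.
Qed.

(** Going once around a cycle would put an edge strictly before itself. *)
Lemma adj_lt_acyclic : acyclic G.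
Proof.
case: lin_r => irr tr _ [//|e p] /= /adj_path_lt /(order_path_min tr) /allP.
by move/(_ e); rewrite mem_rcons mem_head irr => /(_ isT).
Qed.

(** A common element would lie above some outgoing edge and below some incoming one, whereas
    adjacency puts every incoming edge first. *)
Lemma adj_lt_disjoint v : hull r (in_edges v) :&: hull r (out_edges v) = set0.
Proof.
apply/setP=> x; rewrite !in_set0 in_setI; apply/negP => /andP[].
move=> /(hullP lin_r)[_ [d [_ dI _ xd]]] /(hullP lin_r)[a [_ [aO _ ax _]]].
have : r d a by apply/adj_r/(in_out_adj dI).
by rewrite (ord_ltNge lin_r) (ord_le_trans lin_r ax xd).
Qed.

(** Only an incoming lower bound with an outgoing upper bound needs an argument: two bounds of the
    same kind are immediate, and an outgoing edge never lies below an incoming one. *)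
Lemma adj_lt_cover v :
  (forall a b x, a \in in_edges v -> b \in out_edges v ->
     ord_le r a x -> ord_le r x b ->
     x \in hull r (in_edges v) :|: hull r (out_edges v)) ->
  hull r (inc_edges v) = hull r (in_edges v) :|: hull r (out_edges v).
Proof.
move=> between; apply/eqP; rewrite eqEsubset subUset.
rewrite !(hull_mono lin_r) ?subsetUl ?subsetUr // !andbT.
apply/subsetP => x /(hullP lin_r)[a [b []]].
rewrite !in_setU => /orP[aI|aO] /orP[bI|bO] ax xb.
- by apply/orP; left; apply/(hullP lin_r); exists a, b.
- by rewrite -in_setU; apply: between ax xb.
- have : r b a by apply/adj_r/(in_out_adj bI).
  by rewrite (ord_ltNge lin_r) (ord_le_trans lin_r ax xb).
- by apply/orP; right; apply/(hullP lin_r); exists a, b.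
Qed.

End Adjacent.

Hypothesis aupo_r : admissible_UPO_graph s r.

Lemma degree1_source_or_sink v :
  v \in s -> (in_edges v == set0) (+) (out_edges v == set0).
Proof.
case: aupo_r => -[_ deg1] _ _ /deg1; rewrite /degree -!cards_eq0.
by case: #|in_edges v| #|out_edges v| => [|[|?]] [|[|?]].
Qed.

Lemma boundary_in_edges v :
  v \in s -> v \notin output_vertices s -> in_edges v = set0.
Proof.
by move=> vs; have := degree1_source_or_sink vs; rewrite inE vs; case: eqP; case: eqP.
Qed.

Lemma boundary_out_edges v :
  v \in s -> v \notin input_vertices s -> out_edges v = set0.
Proof.
by move=> vs; have := degree1_source_or_sink vs; rewrite inE vs; case: eqP; case: eqP.
Qed.

(** A boundary vertex that receives an edge has, by degree one, no outgoing edge. *)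
Lemma output_edgesE e : (e \in output_edges s) = (tgt e \in output_vertices s).
Proof.
rewrite [LHS]inE; case: (boolP (_ \in output_vertices s)) => [|nout].
  by rewrite inE => /andP[].
apply/negP => /boundary_in_edges /(_ nout) /setP/(_ e).
by rewrite !inE eqxx.
Qed.

Lemma input_edgesE e : (e \in input_edges s) = (src e \in input_vertices s).
Proof.
rewrite [LHS]inE; case: (boolP (_ \in input_vertices s)) => [|nin].
  by rewrite inE => /andP[].
apply/negP => /boundary_out_edges /(_ nin) /setP/(_ e).
by rewrite !inE eqxx.
Qed.

(** Extends admissibility from inner vertices to all vertices that survive in the composite: a
    boundary vertex that is not an output vertex has no incoming edge, so its hull is empty. *)
Lemma output_notin_hull_in v e :
  v \notin output_vertices s -> e \in output_edges s ->
  e \notin hull r (in_edges v).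
Proof.
move=> nout eout; case: (boolP (v \in s)) => vs.
  by rewrite (boundary_in_edges vs nout) (hull0 lin_r) inE.
have [_ /setP/(_ e)] := aupo_admissible aupo_r vs.
by rewrite in_setI eout in_set0 /= => ->.
Qed.

Lemma input_notin_hull_out v e :
  v \notin input_vertices s -> e \in input_edges s ->
  e \notin hull r (out_edges v).
Proof.
move=> nin ein; case: (boolP (v \in s)) => vs.
  by rewrite (boundary_out_edges vs nin) (hull0 lin_r) inE.
have [/setP/(_ e)] := aupo_admissible aupo_r vs.
by rewrite in_setI ein in_set0 /= => ->.
Qed.

End UPO.

(** * The composite: linearity of its order and the embeddings of both edge sets *)

Section Composite.
Variables (G1 G2 : digraph) (s1 : {set vertex G1}) (s2 : {set vertex G2}).
Variables (r1 : rel (edge G1)) (r2 : rel (edge G2)).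
Variables (n : nat) (o : n.-tuple (edge G1)) (i : n.-tuple (edge G2)).
Hypotheses (hG1 : admissible_UPO_graph s1 r1) (hG2 : admissible_UPO_graph s2 r2).
Hypothesis ho : increasing_listing r1 (output_edges s1) o.
Hypothesis hi : increasing_listing r2 (input_edges s2) i.

Local Notation G := (comp_graph s1 s2 o i).
Local Notation sigma := (comp_boundary s1 s2 o i).
Local Notation r := (comp_order s1 s2 r1 r2 o i).
Local Notation lin1 := (upo_linear (aupo_upo hG1)).
Local Notation lin2 := (upo_linear (aupo_upo hG2)).

Lemma comp_order_linear : strict_linear_order r.
Proof.
have [irr1 tr1 tot1] := lin1; have [irr2 tr2 tot2] := lin2; split.
- by move=> [[e|e]|k]; rewrite /comp_order ltnn eqxx ?irr1 ?irr2.
- move=> y x z; rewrite /comp_order => /orP[xy|/andP[/eqP-> xy]].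
    by case/orP=> [yz|/andP[/eqP<- _]]; rewrite ?xy ?(ltn_trans xy yz).
  case/orP=> [->//|/andP[-> yz]]; apply/orP; right; move: xy yz.
  by case: x y z => [[?|?]|?] [[?|?]|?] [[?|?]|?] //=; [apply: tr1|apply: tr2].
- move=> x y xy; rewrite /comp_order eq_sym; case: ltngtP => //= bxy.
  (* Block positions modulo 3 tell the three kinds of edges apart, so [lia] refutes a tie between
     edges of different kinds. *)
  case: x y xy bxy => [[x|x]|k] [[y|y]|l] /= xy bxy; try lia.
  + by apply: tot1; apply: contraNneq xy => /val_inj->.
  + by apply: tot2; apply: contraNneq xy => /val_inj->.
  + by case/eqP: xy; congr inr; apply: val_inj => /=; lia.
Qed.

(** Partial inverse of the embedding [emb1] below. A glued edge has a half in each graph, so [edge1]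
    and [edge2] are both defined on it. *)
Definition edge1 (x : edge G) : option (edge G1) :=
  match (x : comp_edge s1 s2 n) with
  | inl (inl e) => Some (val e)
  | inl (inr _) => None
  | inr k => Some (tnth o k)
  end.

Definition edge2 (x : edge G) : option (edge G2) :=
  match (x : comp_edge s1 s2 n) with
  | inl (inl _) => None
  | inl (inr e) => Some (val e)
  | inr k => Some (tnth i k)
  end.

Lemma edge1_surj e : exists x, edge1 x == Some e.
Proof.
have [/(listing_index ho)[k <-]|eo] := boolP (e \in output_edges s1).
  by exists (inr k).
by exists (inl (inl (exist _ e eo))).
Qed.

Lemma edge2_surj e : exists x, edge2 x == Some e.
Proof.
have [/(listing_index hi)[k <-]|ei] := boolP (e \in input_edges s2).
  by exists (inr k).
by exists (inl (inr (exist _ e ei))).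
Qed.

(** Choosing a preimage avoids a case split on membership in [output_edges s1]; [emb1_eq] shows that
    the preimage is unique. *)
Definition emb1 e : edge G := xchoose (edge1_surj e).
Definition emb2 e : edge G := xchoose (edge2_surj e).

Lemma edge1K e : edge1 (emb1 e) = Some e.
Proof. exact/eqP/(xchooseP (edge1_surj e)). Qed.

Lemma edge2K e : edge2 (emb2 e) = Some e.
Proof. exact/eqP/(xchooseP (edge2_surj e)). Qed.

Lemma comp_order1 x y e f :
  edge1 x = Some e -> edge1 y = Some f -> r x y = r1 e f.
Proof.
rewrite /comp_order.
case: x y => [[[x xo]|x]|k] [[[y yo]|y]|l] //= [<-] [<-].
(* With [c] entries of [o] below an edge, its position is [3 * c + 1]. This is less than [3 * l + 2]
   iff [c <= l], and exceeds [3 * k + 2] iff [k < c]. *)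
- rewrite [RHS](count_below lin1 o); congr (_ || _ && _); lia.
- rewrite (listing_countC lin1 ho) //; lia.
- rewrite (listing_count lin1 ho); lia.
- rewrite (listing_ltn lin1 ho); lia.
Qed.

Lemma comp_order2 x y e f :
  edge2 x = Some e -> edge2 y = Some f -> r x y = r2 e f.
Proof.
rewrite /comp_order.
case: x y => [[x|[x xi]]|k] [[y|[y yi]]|l] //= [<-] [<-].
- rewrite [RHS](count_below lin2 i); congr (_ || _ && _); lia.
- rewrite (listing_countC lin2 hi) //; lia.
- rewrite (listing_count lin2 hi); lia.
- rewrite (listing_ltn lin2 hi); lia.
Qed.

Lemma emb1_mono e f : r (emb1 e) (emb1 f) = r1 e f.
Proof. by apply: comp_order1; apply: edge1K. Qed.

Lemma emb2_mono e f : r (emb2 e) (emb2 f) = r2 e f.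
Proof. by apply: comp_order2; apply: edge2K. Qed.

(** Two distinct edges over [e] would be comparable, and [comp_order1] would turn this into
    [r1 e e]. *)
Lemma emb1_eq x e : edge1 x = Some e -> x = emb1 e.
Proof.
have [irr1 _ _] := lin1; have [_ _ tot] := comp_order_linear.
move=> xe; apply/eqP; apply: contraT => /tot.
by rewrite (comp_order1 xe (edge1K e)) (comp_order1 (edge1K e) xe) irr1.
Qed.

Lemma emb2_eq x e : edge2 x = Some e -> x = emb2 e.
Proof.
have [irr2 _ _] := lin2; have [_ _ tot] := comp_order_linear.
move=> xe; apply/eqP; apply: contraT => /tot.
by rewrite (comp_order2 xe (edge2K e)) (comp_order2 (edge2K e) xe) irr2.
Qed.

Variant emb_spec (x : edge G) : Prop :=
  | Emb1 e of x = emb1 e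
  | Emb2 e of x = emb2 e.

Lemma embP x : emb_spec x.
Proof.
case E: (edge1 x) => [e|]; first exact: Emb1 (emb1_eq E).
case E2: (edge2 x) => [e|]; first exact: Emb2 (emb2_eq E2).
by case: x E E2 => [[]|].
Qed.

Lemma emb_glued k : emb1 (tnth o k) = emb2 (tnth i k).
Proof.
by rewrite -(@emb1_eq (inr k) (tnth o k)) // -(@emb2_eq (inr k) (tnth i k)).
Qed.

Local Notation lin := comp_order_linear.
Local Notation le1 := (embedding_le lin1 lin emb1_mono).
Local Notation le2 := (embedding_le lin2 lin emb2_mono).
Local Notation hull1P := (hull_imsetP emb1 lin _ _).
Local Notation hull2P := (hull_imsetP emb2 lin _ _).
Local Notation mem_hull1 := (mem_hull_imset lin1 lin emb1_mono).
Local Notation mem_hull2 := (mem_hull_imset lin2 lin emb2_mono).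

(** * Separation by glued edges, and the edges at a vertex of the composite *)

(** If either edge is glued, it is itself the separating edge. The property is one-sided: no glued
    edge lies between [P_0] and [Q_1], so an edge of G2 may precede one of G1 without separation. *)
Lemma separation a b : ord_le r (emb1 a) (emb2 b) ->
  exists k, ord_le r1 a (tnth o k) /\ ord_le r2 (tnth i k) b.
Proof.
case Ea: (edge2 (emb1 a)) => [a2|].
  case Ek: (emb1 a) (edge1K a) Ea => [[?|?]|k] //= [<-] _.
  rewrite (@emb2_eq (inr k) (tnth i k)) // le2 => le_kb.
  by exists k; rewrite (ord_lexx r1).
case Eb: (edge1 (emb2 b)) => [b1|].
  case Ek: (emb2 b) (edge2K b) Eb => [[?|?]|k] //= [<-] _.
  rewrite (@emb1_eq (inr k) (tnth o k)) // le1 => le_ak.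
  by exists k; rewrite (ord_lexx r2).
case: (emb1 a) (edge1K a) Ea => [[[e eo]|?]|?] //= [<-] _ {a}.
case: (emb2 b) (edge2K b) Eb => [[?|[f fi]]|?] //= [<-] _ {b}.
rewrite ord_leE /= /comp_order /= andbF orbF => lt_ef.
(* Let [c] entries of [o] precede [e] and [d] entries of [i] precede [f]. The blocks give
   [3 * c + 1 < 3 * d], so [c < d <= n], and the glued edge of index [c] is the first one above [e]
   and is still below [f]. *)
have lt_n : count (r1^~ e) o < n.
  have := count_size (r2^~ f) i; rewrite size_tuple; lia.
exists (Ordinal lt_n); split; apply: ord_ltW.
  by rewrite (listing_countC lin1 ho) /=.
by rewrite (listing_count lin2 hi) /=; lia.
Qed.

Lemma in_edges_inl v :
  in_edges (inl v : vertex G) = emb1 @: in_edges (val v).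
Proof.
apply/setP=> x; rewrite inE; apply/eqP/imsetP => [|[e]].
  by case: x => [[e|//]|//] [<-]; exists (val e); rewrite ?inE //; apply: emb1_eq.
rewrite inE => /eqP tv ->; case: (emb1 e) (edge1K e) => [[f|//]|k] /= [fe].
  by congr inl; apply: val_inj; rewrite /= fe.
(* If [e] were an output edge, [v] would be an output vertex, and those are deleted. *)
have := listing_mem ho k; rewrite (output_edgesE hG1) fe tv.
by rewrite (negbTE (valP v)).
Qed.

Lemma out_edges_inl v :
  out_edges (inl v : vertex G) = emb1 @: out_edges (val v).
Proof.
apply/setP=> x; rewrite inE; apply/eqP/imsetP => [|[e]].
  case: x => [[e|//]|k] [<-]; [exists (val e)|exists (tnth o k)];
  by rewrite ?inE //; apply: emb1_eq.
rewrite inE => /eqP tv ->; case: (emb1 e) (edge1K e) => [[f|//]|k] /= [fe];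
by congr inl; apply: val_inj; rewrite /= fe.
Qed.

Lemma in_edges_inr v :
  in_edges (inr v : vertex G) = emb2 @: in_edges (val v).
Proof.
apply/setP=> x; rewrite inE; apply/eqP/imsetP => [|[e]].
  case: x => [[//|e]|k] [<-]; [exists (val e)|exists (tnth i k)];
  by rewrite ?inE //; apply: emb2_eq.
rewrite inE => /eqP tv ->; case: (emb2 e) (edge2K e) => [[//|f]|k] /= [fe];
by congr inr; apply: val_inj; rewrite /= fe.
Qed.

Lemma out_edges_inr v :
  out_edges (inr v : vertex G) = emb2 @: out_edges (val v).
Proof.
apply/setP=> x; rewrite inE; apply/eqP/imsetP => [|[e]].
  by case: x => [[//|e]|//] [<-]; exists (val e); rewrite ?inE //; apply: emb2_eq.
rewrite inE => /eqP tv ->; case: (emb2 e) (edge2K e) => [[//|f]|k] /= [fe].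
  by congr inr; apply: val_inj; rewrite /= fe.
have := listing_mem hi k; rewrite (input_edgesE hG2) fe tv.
by rewrite (negbTE (valP v)).
Qed.

(** All edges at the vertex shared by [x] and [y] come from the graph of that vertex, so the
    comparison takes place there. *)
Lemma comp_adj_lt (x y : edge G) : adj x y -> r x y.
Proof.
rewrite /adj /= => /eqP xy.
have xI : x \in in_edges (tgt x) by rewrite inE.
have yO : y \in out_edges (tgt x) by rewrite inE /= xy.
case: (tgt x) xI yO => v.
  rewrite in_edges_inl out_edges_inl => /imsetP[e eI ->] /imsetP[f fO ->].
  rewrite emb1_mono; apply: (upo_path (aupo_upo hG1)).
  exact/adj_leads_to/(in_out_adj eI).
rewrite in_edges_inr out_edges_inr => /imsetP[e eI ->] /imsetP[f fO ->].
rewrite emb2_mono; apply: (upo_path (aupo_upo hG2)).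
exact/adj_leads_to/(in_out_adj eI).
Qed.

(** * Hulls of incoming and outgoing edges in the composite *)

Lemma glued_notin_hull_in k v :
  v \notin output_vertices s1 -> tnth o k \notin hull r1 (in_edges v).
Proof. by move=> nv; apply: (output_notin_hull_in lin1 hG1 nv (listing_mem ho k)). Qed.

Lemma glued_notin_hull_out k v :
  v \notin input_vertices s2 -> tnth i k \notin hull r2 (out_edges v).
Proof. by move=> nv; apply: (input_notin_hull_out lin2 hG2 nv (listing_mem hi k)). Qed.

(** An edge of G2 in this hull would lie above some edge of I(v), and the glued edge separating the
    two would fall into the hull of I(v) in G1. *)
Lemma emb2_notin_hull_in v x :
  v \notin output_vertices s1 -> emb2 x \notin hull r (emb1 @: in_edges v).
Proof.
move=> nv; apply/negP => /hull1P[a [b [aI bI /separation[k [ak kx]] xb]]].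
case/negP: (glued_notin_hull_in k nv); apply/(hullP lin1); exists a, b.
by split=> //; rewrite -le1 emb_glued (ord_le_trans lin _ xb) // le2.
Qed.

Lemma emb1_notin_hull_out v x :
  v \notin input_vertices s2 -> emb1 x \notin hull r (emb2 @: out_edges v).
Proof.
move=> nv; apply/negP => /hull2P[a [b [aO bO ax /separation[k [xk kb]]]]].
case/negP: (glued_notin_hull_out k nv); apply/(hullP lin2); exists a, b.
by split=> //; rewrite -le2 -emb_glued (ord_le_trans lin ax) // le1.
Qed.

Lemma comp_cover v :
  hull r (inc_edges v) = hull r (in_edges v) :|: hull r (out_edges v).
Proof.
apply: (adj_lt_cover lin comp_adj_lt) => a b x.
case: v => v.
  rewrite in_edges_inl out_edges_inl => /imsetP[a1 aI ->] /imsetP[b1 bO ->] ax xb.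
  have mid y : ord_le r1 a1 y -> ord_le r1 y b1 ->
      (y \in hull r1 (in_edges (val v))) || (y \in hull r1 (out_edges (val v))).
    move=> ay yb; rewrite -in_setU -(upo_cover (aupo_upo hG1)).
    by apply/(hullP lin1); exists a1, b1; rewrite !in_setU aI bO orbT.
  case: (embP x) ax xb => {x} x -> ax xb.
    by rewrite in_setU !mem_hull1; apply: mid; rewrite -le1.
  (* Here [x] comes from G2. The glued edge between [a1] and [x] lies in the hull of I(v) or of O(v)
     in G1, and admissibility leaves only O(v). Hence [x] lies above some outgoing edge [c], and
     below [b1]. *)
  have [k [ak kx]] := separation ax.
  have kx' : ord_le r (emb1 (tnth o k)) (emb2 x) by rewrite emb_glued le2.
  have kb : ord_le r1 (tnth o k) b1 by rewrite -le1 (ord_le_trans lin kx').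
  have := mid _ ak kb; rewrite (negbTE (glued_notin_hull_in k (valP v))) /=.
  case/(hullP lin1) => c [_ [cO _ ck _]].
  rewrite in_setU; apply/orP; right; apply/hull1P; exists c, b1; split=> //.
  by apply: ord_le_trans lin _ _ _ _ kx'; rewrite le1.
rewrite in_edges_inr out_edges_inr => /imsetP[a2 aI ->] /imsetP[b2 bO ->] ax xb.
have mid y : ord_le r2 a2 y -> ord_le r2 y b2 ->
    (y \in hull r2 (in_edges (val v))) || (y \in hull r2 (out_edges (val v))).
  move=> ay yb; rewrite -in_setU -(upo_cover (aupo_upo hG2)).
  by apply/(hullP lin2); exists a2, b2; rewrite !in_setU aI bO orbT.
case: (embP x) ax xb => {x} x -> ax xb; last first.
  by rewrite in_setU !mem_hull2; apply: mid; rewrite -le2.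
(* Dually, the glued edge between [x] and [b2] must lie in the hull of I(v), which bounds [x] above
   by an incoming edge [d]. *)
have [k [xk kb]] := separation xb.
have xk' : ord_le r (emb1 x) (emb2 (tnth i k)) by rewrite -emb_glued le1.
have ak : ord_le r2 a2 (tnth i k) by rewrite -le2 (ord_le_trans lin ax).
have := mid _ ak kb; rewrite (negbTE (glued_notin_hull_out k (valP v))) orbF.
case/(hullP lin2) => _ [d [_ dI _ kd]].
rewrite in_setU; apply/orP; left; apply/hull2P; exists a2, d; split=> //.
by apply: ord_le_trans lin _ _ _ xk' _; rewrite le2.
Qed.

(* Two edges of I(v1) are never separated by a glued edge, so they lie on the
   same side of every edge of G2. *)
Lemma in_edges_cross v1 e (Y : {set edge G2}) :
  v1 \notin output_vertices s1 -> e \in in_edges v1 ->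
  emb1 e \in hull r (emb2 @: Y) ->
  emb1 @: in_edges v1 \subset hull r (emb2 @: Y).
Proof.
move=> nv eI /hull2P[a [b [aY bY ae eb]]].
apply/subsetP => _ /imsetP[f fI ->]; apply/hull2P; exists a, b; split=> //.
  case/orP: (ord_le_total lin (emb2 a) (emb1 f)) => // /separation[k [fk ka]].
  case/negP: (glued_notin_hull_in k nv); apply/(hullP lin1); exists f, e.
  by split=> //; rewrite -le1 emb_glued (ord_le_trans lin _ ae) // le2.
case/orP: (ord_le_total lin (emb1 f) (emb2 b)) => // bf.
have [k [ek kb]] := separation eb.
case/negP: (glued_notin_hull_in k nv); apply/(hullP lin1); exists e, f.
by split=> //; rewrite -le1 emb_glued (ord_le_trans lin _ bf) // le2.
Qed.

(** Dual to [in_edges_cross]: were [f] outside the bounds of [e], a glued edge would lie between two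
    edges of O(v2). *)
Lemma out_edges_cross v2 e (Y : {set edge G1}) :
  v2 \notin input_vertices s2 -> e \in out_edges v2 ->
  emb2 e \in hull r (emb1 @: Y) ->
  emb2 @: out_edges v2 \subset hull r (emb1 @: Y).
Proof.
move=> nv eO /hull1P[a [b [aY bY ae eb]]].
apply/subsetP => _ /imsetP[f fO ->]; apply/hull1P; exists a, b; split=> //.
  case/orP: (ord_le_total lin (emb1 a) (emb2 f)) => // fa.
  have [k [ak ke]] := separation ae.
  case/negP: (glued_notin_hull_out k nv); apply/(hullP lin2); exists f, e.
  by split=> //; rewrite -le2 -emb_glued (ord_le_trans lin fa) // le1.
case/orP: (ord_le_total lin (emb2 f) (emb1 b)) => // /separation[k [bk kf]].
case/negP: (glued_notin_hull_out k nv); apply/(hullP lin2); exists e, f.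
by split=> //; rewrite -le2 -emb_glued (ord_le_trans lin eb) // le1.
Qed.

Lemma comp_upo : upward_planar_order r.
Proof.
split.
- exact: lin.
- exact: leads_to_lt lin comp_adj_lt.
- exact: adj_lt_disjoint lin comp_adj_lt.
- exact: comp_cover.
(* Vertices of the same graph inherit the inclusion. Of the mixed cases, [v1] in G1 is
   [in_edges_cross], and [v1] in G2 is vacuous because the hull of I(v2) contains no edge of G2. *)
- move=> [v1|v1] [v2|v2] /set0Pn[x] /setIP[]; rewrite ?in_edges_inl ?in_edges_inr;
    move=> /imsetP[e eI ->].
  + rewrite mem_hull1 => eH; apply/(hull_imset_sub lin1 lin emb1_mono).
    by apply/(upo_in (aupo_upo hG1))/set0Pn; exists e; rewrite inE eI.
  + by move=> eH; apply/(hull_min lin)/(in_edges_cross (valP v1) eI eH).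
  + by rewrite (negbTE (emb2_notin_hull_in _ (valP v2))).
  + rewrite mem_hull2 => eH; apply/(hull_imset_sub lin2 lin emb2_mono).
    by apply/(upo_in (aupo_upo hG2))/set0Pn; exists e; rewrite inE eI.
- move=> [v1|v1] [v2|v2] /set0Pn[x] /setIP[]; rewrite ?out_edges_inl ?out_edges_inr;
    move=> /imsetP[e eO ->].
  + rewrite mem_hull1 => eH; apply/(hull_imset_sub lin1 lin emb1_mono).
    by apply/(upo_out (aupo_upo hG1))/set0Pn; exists e; rewrite inE eO.
  + by rewrite (negbTE (emb1_notin_hull_out _ (valP v2))).
  + by move=> eH; apply/(hull_min lin)/(out_edges_cross (valP v1) eO eH).
  + rewrite mem_hull2 => eH; apply/(hull_imset_sub lin2 lin emb2_mono).
    by apply/(upo_out (aupo_upo hG2))/set0Pn; exists e; rewrite inE eO.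
Qed.

Lemma comp_progressive : progressive sigma.
Proof.
split=> [|[v|v]]; first exact: adj_lt_acyclic lin comp_adj_lt.
  rewrite !inE /degree in_edges_inl out_edges_inl => /andP[vs _].
  rewrite !(card_imset _ (embedding_inj lin1 lin emb1_mono)).
  by have [[_ deg1] _ _] := hG1; apply: deg1.
rewrite !inE /degree in_edges_inr out_edges_inr => /andP[vs _].
rewrite !(card_imset _ (embedding_inj lin2 lin emb2_mono)).
by have [[_ deg1] _ _] := hG2; apply: deg1.
Qed.

Lemma comp_input_edges x :
  x \in input_edges sigma -> exists2 e, x = emb1 e & e \in input_edges s1.
Proof.
rewrite inE /= inE; case: x => [[e|e]|k] /=.
- by rewrite -(input_edgesE hG1); exists (val e); [apply: emb1_eq|].
(* The boundary vertices kept from G2 are output vertices, which start no edge. *)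
- by rewrite (negbTE (src_not_output _ _)).
- by rewrite -(input_edgesE hG1); exists (tnth o k); [apply: emb1_eq|].
Qed.

Lemma comp_output_edges x :
  x \in output_edges sigma -> exists2 e, x = emb2 e & e \in output_edges s2.
Proof.
rewrite inE /= inE; case: x => [[e|e]|k] /=.
- by rewrite (negbTE (tgt_not_input _ _)).
- by rewrite -(output_edgesE hG2); exists (val e); [apply: emb2_eq|].
- by rewrite -(output_edgesE hG2); exists (tnth i k); [apply: emb2_eq|].
Qed.

Lemma comp_admissible : admissible sigma r.
Proof.
move=> v; rewrite inE => nv.
split; apply/setP=> x; rewrite in_set0; apply/negP => /setIP[].
  (* Input edges of the composite come from G1: for [v] in G1 admissibility of G1 applies, and for
     [v] in G2 the hull of O(v) contains no edge of G1. *)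
  case/comp_input_edges => e -> ein; case: v nv => v nv.
    rewrite out_edges_inl mem_hull1; apply/negP.
    exact: (input_notin_hull_out lin1 hG1 nv ein).
  by rewrite out_edges_inr; rewrite (negbTE (emb1_notin_hull_out _ (valP v))).
case/comp_output_edges => e -> eout; case: v nv => v nv.
  by rewrite in_edges_inl; rewrite (negbTE (emb2_notin_hull_in _ (valP v))).
rewrite in_edges_inr mem_hull2; apply/negP.
exact: (output_notin_hull_in lin2 hG2 nv eout).
Qed.

End Composite.

Theorem theorem4p4
  (G1 G2 : digraph) (s1 : {set vertex G1}) (s2 : {set vertex G2})
  (r1 : rel (edge G1)) (r2 : rel (edge G2))
  (n : nat) (o : n.-tuple (edge G1)) (i : n.-tuple (edge G2))
  (hG1 : admissible_UPO_graph s1 r1)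
  (hG2 : admissible_UPO_graph s2 r2)
  (ho : increasing_listing r1 (output_edges s1) o)
  (hi : increasing_listing r2 (input_edges s2) i) :
  admissible_UPO_graph (comp_boundary s1 s2 o i) (comp_order s1 s2 r1 r2 o i).
Proof.
by split; [apply: comp_progressive | apply: comp_upo | apply: comp_admissible];
  eassumption.
Qed.
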